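(* Let $P\subset\mathbb{R}^d$ be a finite point set with an optimal $k$-means clustering $O_1,\dots,O_k$ with centers $c_1^*,\dots,c_k^*$, and let $\nu=\max_{i,j\in[k]}\frac{|O_i|}{|O_j|}$. Assume that $P$ satisfies $(2+2\sqrt{2\nu}+\epsilon)$-center separation with respect to $O_1,\dots,O_k$ for some $\epsilon>0$, i.e., $\|c_j^*-c_i^*\|\ge(2+2\sqrt{2\nu}+\epsilon)\max_{\ell\in[k]}\max_{x\in O_\ell}\|x-c_\ell^*\|$ for all $i\ne j$. Then the $k$-clustering computed by Ward's method on $P$ is exactly $\{O_1,\dots,O_k\}$.
   Context: For a finite nonempty $Q\subset\mathbb{R}^d$, $\mu(Q)$ denotes its centroid and $\Delta(Q)=\sum_{q\in Q}\|q-\mu(Q)\|^2$. For disjoint finite nonempty $A,B$, $D(A,B)=\Delta(A\cup B)-\Delta(A)-\Delta(B)$. An optimal $k$-means clustering is a partition of $P$ into $k$ clusters minimizing $\sum_i\Delta(O_i)$; its centers are $c_i^*=\mu(O_i)$. Ward's method starts with the $|P|$ singleton clusters and repeatedly merges two current clusters $A,B$ minimizing $D(A,B)$ (ties broken arbitrarily); its $k$-clustering is the clustering after $|P|-k$ merges. *)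

(* Defs.v *)
From HB Require Import structures.
From mathcomp Require Import all_boot all_order all_algebra finmap reals.

Set Implicit Arguments.
Unset Strict Implicit.
Unset Printing Implicit Defensive.

Import Order.TTheory GRing.Theory Num.Theory.
Local Open Scope ring_scope.
Local Open Scope fset_scope.

Section Ward.
Variables (R : realType) (d : nat).
Local Notation point := 'rV[R]_d.
Implicit Types (P Q A B : {fset point}) (C : {fset {fset point}}).

Definition enorm (v : point) : R := Num.sqrt (\sum_(i < d) v ord0 i ^+ 2).

Definition centroid Q : point := (#|` Q|%:R : R)^-1 *: \sum_(q <- Q) q.

Definition Delta Q : R := \sum_(q <- Q) enorm (q - centroid Q) ^+ 2.

Definition merge_cost A B : R := Delta (A `|` B) - Delta A - Delta B.

Definition is_partition P (k : nat) (O : 'I_k -> {fset point}) : Prop :=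
  [/\ forall i, O i != fset0,
      forall i j, i != j -> [disjoint O i & O j]%fset
    & \big[fsetU/fset0]_(i < k) O i = P].

Definition kmeans_cost (k : nat) (O : 'I_k -> {fset point}) : R :=
  \sum_(i < k) Delta (O i).

Definition optimal_kmeans P (k : nat) (O : 'I_k -> {fset point}) : Prop :=
  is_partition P O /\
  forall O' : 'I_k -> {fset point},
    is_partition P O' -> kmeans_cost O <= kmeans_cost O'.

(* In the next two maxima all terms are nonnegative, so the default value 0
   has no effect as soon as k > 0 and the clusters are nonempty. *)
Definition size_ratio (k : nat) (O : 'I_k -> {fset point}) : R :=
  \big[Num.max/0]_(i < k) \big[Num.max/0]_(j < k)
    (#|` O i|%:R / #|` O j|%:R).

Definition max_radius (k : nat) (O : 'I_k -> {fset point}) : R :=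
  \big[Num.max/0]_(l < k) \big[Num.max/0]_(x <- O l) enorm (x - centroid (O l)).

Definition center_separation (delta : R) (k : nat)
    (O : 'I_k -> {fset point}) : Prop :=
  forall i j, i != j ->
    delta * max_radius O <= enorm (centroid (O j) - centroid (O i)).

Definition singletons P : {fset {fset point}} := [fset [fset x] | x in P].

Definition ward_step C C' : Prop :=
  exists A B : {fset point},
    [/\ A \in C, B \in C, A != B,
        forall A' B', A' \in C -> B' \in C -> A' != B' ->
          merge_cost A B <= merge_cost A' B'
      & C' = (A `|` B) |` (C `\ A `\ B)].

(* ward_run P m C: C is a possible state after exactly m merges; ties make this
   a relation rather than a function. *)
Inductive ward_run P : nat -> {fset {fset point}} -> Prop :=
  | WardStart : ward_run P 0 (singletons P)
  | WardMerge m C C' : ward_run P m C -> ward_step C C' -> ward_run P m.+1 C'.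

Definition ward_clustering P (k : nat) C : Prop :=
  ward_run P (#|` P| - k)%N C.

End Ward.

(* Main.v *)
(* Writing r for the maximal radius and nu for the size ratio, Ward's method only
   merges clusters lying in a common O_i until k clusters remain. Indeed
   D(A, B) = |A||B| / (|A| + |B|) * |mu(A) - mu(B)|^2, which is less than
   4 |A| r^2 when A and B lie in a common O_i, and at least 4 nu |A| r^2 when they
   lie in different ones and |A| <= |B|, because the separation keeps the two
   centroids at distance at least 2 sqrt(2 nu) r. While more than k clusters remain,
   any A in O_i admits a pair A', B' in a common O_l with |A'| <= nu |A|: take
   A' = A if A is not all of O_i, and otherwise split O_l by pigeonhole, so that
   |A'| <= |O_l| <= nu |O_i|. Hence a minimizing pair never crosses clusters. *)

Require Import Defs.
From HB Require Import structures.
From mathcomp Require Import all_boot all_order all_algebra finmap reals.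
From mathcomp Require Import ring lra.

Set Implicit Arguments.
Unset Strict Implicit.
Unset Printing Implicit Defensive.

Import Order.TTheory GRing.Theory Num.Theory.
Local Open Scope ring_scope.
Local Open Scope fset_scope.

(** * Inner product and Euclidean norm *)

Section EuclideanNorm.
Local Open Scope ring_scope.
Variables (R : realType) (d : nat).
Local Notation point := 'rV[R]_d.
Implicit Types u v w : point.

Definition dot u v : R := \sum_(i < d) u ord0 i * v ord0 i.

Lemma dotC u v : dot u v = dot v u.
Proof. by apply: eq_bigr => i _; rewrite mulrC. Qed.

Lemma dotDl u v w : dot (u + v) w = dot u w + dot v w.
Proof. by rewrite -big_split; apply: eq_bigr => i _; rewrite mxE mulrDl. Qed.

Lemma dotZl a u v : dot (a *: u) v = a * dot u v.
Proof. by rewrite mulr_sumr; apply: eq_bigr => i _; rewrite mxE mulrA. Qed.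

Lemma dotDr u v w : dot w (u + v) = dot w u + dot w v.
Proof. by rewrite !(dotC w) dotDl. Qed.

Lemma dotZr a u v : dot v (a *: u) = a * dot v u.
Proof. by rewrite !(dotC v) dotZl. Qed.

Lemma dotNl u v : dot (- u) v = - dot u v.
Proof. by rewrite -scaleN1r dotZl mulN1r. Qed.

Lemma dotNr u v : dot v (- u) = - dot v u.
Proof. by rewrite !(dotC v) dotNl. Qed.

Lemma dot0l v : dot 0 v = 0.
Proof. by rewrite -(scale0r 0) dotZl mul0r. Qed.

Lemma dot_suml (I : Type) (s : seq I) (F : I -> point) v :
  dot (\sum_(i <- s) F i) v = \sum_(i <- s) dot (F i) v.
Proof.
exact: (big_morph (fun u => dot u v) (fun x y => dotDl x y v) (dot0l v)).
Qed.

Definition dotE := (dotDl, dotDr, dotZl, dotZr, dotNl, dotNr).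

Lemma dot_ge0 u : 0 <= dot u u.
Proof. by apply: sumr_ge0 => i _; rewrite -expr2 sqr_ge0. Qed.

Lemma enorm_sqr u : enorm u ^+ 2 = dot u u.
Proof.
rewrite /enorm (eq_bigr (fun i => u ord0 i * u ord0 i)) => [|i _].
  by rewrite sqr_sqrtr ?dot_ge0.
by rewrite expr2.
Qed.

Lemma enorm_ge0 u : 0 <= enorm u.
Proof. exact: sqrtr_ge0. Qed.

Lemma dot_eq0 u : dot u u = 0 -> u = 0.
Proof.
move=> /eqP; rewrite psumr_eq0 => [/allP u0|i _]; last by rewrite -expr2 sqr_ge0.
apply/rowP => i; rewrite mxE; apply/eqP.
by have := u0 i (mem_index_enum i); rewrite mulf_eq0 orbb.
Qed.

Lemma enorm_eq0 u : enorm u = 0 -> u = 0.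
Proof. by move=> u0; apply: dot_eq0; rewrite -enorm_sqr u0 expr0n. Qed.

Lemma enorm0 : enorm (0 : point) = 0.
Proof. by apply/eqP; rewrite -sqrf_eq0 enorm_sqr dot0l. Qed.

Lemma enormZ a u : enorm (a *: u) = `|a| * enorm u.
Proof.
apply/eqP; rewrite -(@eqrXn2 _ 2) ?mulr_ge0 ?enorm_ge0 //.
by rewrite exprMn !enorm_sqr !dotE real_normK ?num_real // mulrA -expr2.
Qed.

Lemma enormN u : enorm (- u) = enorm u.
Proof. by rewrite -scaleN1r enormZ normrN1 mul1r. Qed.

(** With a = |u| and b = |v|, the square |b u - a v|^2 equals 2ab(ab - u.v) and is nonnegative;
    divide by ab once the zero vectors are set aside. *)
Lemma cauchy_schwarz u v : dot u v <= enorm u * enorm v.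
Proof.
have := dot_ge0 (enorm v *: u - enorm u *: v).
rewrite !dotE (dotC v u) -!enorm_sqr => h.
have [->|u0] := eqVneq u 0.
  by rewrite enorm0 mul0r dot0l.
have [->|v0] := eqVneq v 0.
  by rewrite enorm0 mulr0 dotC dot0l.
have pos w : w != 0 -> 0 < enorm w.
  by move=> w0; rewrite lt0r enorm_ge0 andbT; apply: contraNneq w0 => /enorm_eq0->.
rewrite -subr_ge0 -(pmulr_rge0 _ (mulr_gt0 (pos u u0) (pos v v0))).
lra.
Qed.

Lemma enormD u v : enorm (u + v) <= enorm u + enorm v.
Proof.
rewrite -(@ler_pXn2r _ 2) ?nnegrE ?addr_ge0 ?enorm_ge0 //.
rewrite enorm_sqr !dotE (dotC v u) sqrrD !enorm_sqr.
have := cauchy_schwarz u v; lra.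
Qed.

Lemma enorm_sum (I : Type) (s : seq I) (F : I -> point) :
  enorm (\sum_(i <- s) F i) <= \sum_(i <- s) enorm (F i).
Proof.
elim/big_ind2: _ => [|x u y v ux vy|//]; first by rewrite enorm0.
exact: le_trans (enormD _ _) (lerD ux vy).
Qed.

End EuclideanNorm.

(** * Centroids and the closed form of the merge cost *)

Section Centroid.
Local Open Scope ring_scope.
Variables (R : realType) (d : nat).
Local Notation point := 'rV[R]_d.
Implicit Types (A B Q : {fset point}) (z : point).

Lemma card_gt0R Q : Q != fset0 -> 0 < #|` Q|%:R :> R.
Proof. by rewrite ltr0n cardfs_gt0. Qed.

(** The general module [V] lets this serve both for vectors and, at [R^o], for real constants. *)
Lemma sum_constE (V : lmodType R) Q (v : V) : \sum_(q <- Q) v = #|` Q|%:R *: v.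
Proof. by rewrite big_const_seq count_predT iter_addr_0 scaler_nat. Qed.

Lemma centroidK Q : Q != fset0 -> #|` Q|%:R *: centroid Q = \sum_(q <- Q) q.
Proof. by move=> /card_gt0R/lt0r_neq0 Q0; rewrite scalerA mulfV ?scale1r. Qed.

Lemma sum_centroid_sub Q z : Q != fset0 ->
  \sum_(q <- Q) (q - z) = #|` Q|%:R *: (centroid Q - z).
Proof. by move=> Q0; rewrite big_split /= sum_constE scalerN scalerBr centroidK. Qed.

Lemma centroid_ball Q z (r : R) : Q != fset0 ->
  (forall q, q \in Q -> enorm (q - z) <= r) -> enorm (centroid Q - z) <= r.
Proof.
move=> Q0 Qr; have Qp := card_gt0R Q0.
rewrite -(ler_pM2l Qp) -{1}(ger0_norm (ltW Qp)) -enormZ -sum_centroid_sub //.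
apply: le_trans (enorm_sum _ _) _.
apply: (@le_trans _ _ (\sum_(q <- Q) r)).
  by rewrite !big_seq; apply: ler_sum.
by rewrite (sum_constE (V := R^o)).
Qed.

(** Expand each square around the centroid: the cross terms cancel because deviations from the
    centroid sum to zero. *)
Lemma parallel_axis Q z : Q != fset0 ->
  \sum_(q <- Q) enorm (q - z) ^+ 2 =
    Delta Q + #|` Q|%:R * enorm (centroid Q - z) ^+ 2.
Proof.
move=> Q0; set c := centroid Q.
have -> : #|` Q|%:R * enorm (c - z) ^+ 2 = \sum_(q <- Q) enorm (c - z) ^+ 2.
  by rewrite (sum_constE (V := R^o)).
have cross : \sum_(q <- Q) dot (q - c) (c - z) = 0.
  by rewrite -dot_suml sum_centroid_sub // subrr scaler0 dot0l.
apply/eqP; rewrite -subr_eq0; apply/eqP.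
transitivity (2 * \sum_(q <- Q) dot (q - c) (c - z)); last by rewrite cross mulr0.
rewrite mulr_sumr /Delta -/c -big_split -sumrB.
apply: eq_bigr => q _ /=.
rewrite (_ : q - z = (q - c) + (c - z)); last by rewrite addrA subrK.
move: (q - c) (c - z) => u v.
by rewrite !enorm_sqr dotDl !dotDr (dotC v u); ring.
Qed.

Lemma perm_fsetU A B : [disjoint A & B] -> perm_eq (A `|` B) (A ++ B).
Proof.
move=> /fdisjointP dAB; apply: uniq_perm; rewrite ?fset_uniq //.
  rewrite cat_uniq !fset_uniq andbT /=; apply/hasPn => x xB /=.
  by apply: contraL xB => /dAB.
by move=> x; rewrite in_fsetU mem_cat.
Qed.

(** Apply the parallel axis identity to A and to B, with z the centroid of the union. That point is
    the weighted mean, so with s = a + b the two displacements are (b/s) w and -(a/s) w, and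
    a(b/s)^2 + b(a/s)^2 = ab/s. *)
Lemma merge_costE A B : A != fset0 -> B != fset0 -> [disjoint A & B] ->
  merge_cost A B = #|` A|%:R * #|` B|%:R / (#|` A|%:R + #|` B|%:R) *
                   enorm (centroid A - centroid B) ^+ 2.
Proof.
move=> A0 B0 dAB; have pAB := perm_fsetU dAB.
have a0 := card_gt0R A0; have b0 := card_gt0R B0.
have s0 := addr_gt0 a0 b0.
have cU : #|` A `|` B| = (#|` A| + #|` B|)%N.
  by rewrite -size_cat; exact: perm_size.
have mU : (#|` A|%:R + #|` B|%:R) *: centroid (A `|` B)
    = #|` A|%:R *: centroid A + #|` B|%:R *: centroid B.
  rewrite -natrD -cU !centroidK // ?(perm_big _ pAB) ?big_cat //.
  by rewrite -cardfs_gt0 cU addn_gt0 cardfs_gt0 A0.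
rewrite /merge_cost {1}/Delta (perm_big _ pAB) big_cat /= !parallel_axis //.
set a : R := #|` A|%:R in a0 s0 mU *; set b : R := #|` B|%:R in b0 s0 mU *.
set s := a + b in s0 mU *.
have -> : centroid (A `|` B) = s^-1 *: (a *: centroid A + b *: centroid B).
  by rewrite -mU scalerA mulVf ?scale1r ?lt0r_neq0.
set w := centroid A - centroid B.
have -> : centroid A - s^-1 *: (a *: centroid A + b *: centroid B) = (b / s) *: w.
  apply/rowP => i; by rewrite !mxE /s; field; rewrite !lt0r_neq0.
have -> : centroid B - s^-1 *: (a *: centroid A + b *: centroid B) = - (a / s) *: w.
  apply/rowP => i; by rewrite !mxE /s; field; rewrite !lt0r_neq0.
rewrite !enormZ !exprMn !real_normK ?num_real //.
by rewrite /s; field; rewrite !lt0r_neq0.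
Qed.

End Centroid.

(** * Clusterings finer than the optimal one *)

Section Ward.
Local Open Scope ring_scope.
Variables (R : realType) (d k : nat).
Local Notation point := 'rV[R]_d.
Variables (P : {fset point}) (O : 'I_k -> {fset point}).
Implicit Types (A B : {fset point}) (C : {fset {fset point}}).

Hypothesis partO : is_partition P O.

Let O_neq0 i : O i != fset0. Proof. by case: partO. Qed.

Let O_inj i j x : x \in O i -> x \in O j -> i = j.
Proof.
case: partO => _ dO _ xi xj; apply/eqP; apply: contraLR xj => ij.
by have /fdisjointP := dO _ _ ij; apply.
Qed.

(** The invariant of Ward's run. The last two clauses together force the union of C to be P. *)
Definition refinement C : Prop :=
  [/\ forall A, A \in C -> A != fset0,
      forall A B, A \in C -> B \in C -> A != B -> [disjoint A & B],
      forall A, A \in C -> exists i, A `<=` O i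
    & forall i x, x \in O i -> exists2 A, A \in C & x \in A].

Lemma refinement_singletons : refinement (singletons P).
Proof.
case: partO => _ _ OP; split.
- by move=> A /imfsetP[x _ ->]; apply/fset0Pn; exists x; rewrite in_fset1.
- move=> A B /imfsetP[x _ ->] /imfsetP[y _ ->] xy.
  by rewrite fdisjoint1X in_fset1; apply: contraNneq xy => ->.
- move=> A /imfsetP[x /=]; rewrite -OP => /bigfcupP[i _ xi] ->; exists i.
  by rewrite fsub1set.
- move=> i x xi; exists [fset x]; rewrite ?in_fset1 //; apply: in_imfset.
  by rewrite /= -OP; apply/bigfcupP; exists i; rewrite ?mem_index_enum.
Qed.

Lemma card_singletons : #|` singletons P| = #|` P|.
Proof. by rewrite card_imfset //; exact: fset1_inj. Qed.

Lemma card_merge C A B : refinement C -> A \in C -> B \in C -> A != B ->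
  #|` C| = #|` (A `|` B) |` (C `\ A `\ B)|.+1.
Proof.
move=> [n0 dC _ _] AC BC AB.
(* The union is a new member: otherwise a member other than A would meet the nonempty A. *)
have nU : A `|` B \notin C `\ A `\ B.
  rewrite !inE; apply/and3P=> -[UB UA UC].
  have := dC _ _ UC AC UA; rewrite fdisjointUX => /andP[/eqP].
  by rewrite fsetIid => A0; have := n0 _ AC; rewrite A0 eqxx.
rewrite cardfsU1 nU (cardfsD1 A) AC (cardfsD1 B (C `\ A)).
by rewrite !inE BC eq_sym AB.
Qed.

Lemma refinement_merge C A B i : refinement C ->
  A \in C -> B \in C -> A `<=` O i -> B `<=` O i ->
  refinement ((A `|` B) |` (C `\ A `\ B)).
Proof.
move=> [n0 dC sub cov] AC BC Ai Bi.
have dU D : D \in C -> D != A -> D != B -> [disjoint A `|` B & D].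
  by move=> DC DA DB; rewrite fdisjointUX !dC // eq_sym.
split.
- move=> D; rewrite !inE => /orP[/eqP->|/and3P[_ _ /n0 //]].
  rewrite -cardfs_gt0 (leq_trans _ (fsubset_leq_card (fsubsetUl A B))) //.
  by rewrite cardfs_gt0 n0.
- move=> D E; rewrite !inE => /orP[/eqP->|/and3P[DB DA DC]].
    move=> /orP[/eqP->|/and3P[EB EA EC] _]; first by rewrite eqxx.
    exact: dU.
  move=> /orP[/eqP-> _|/and3P[_ _ EC]]; last exact: dC.
  by rewrite fdisjoint_sym dU.
- move=> D; rewrite !inE => /orP[/eqP->|/and3P[_ _ /sub //]].
  by exists i; rewrite fsubUset Ai Bi.
- move=> j x /cov[D DC xD].
  have [DA|DA] := eqVneq D A.
    by exists (A `|` B); rewrite !inE ?eqxx // -DA xD.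
  have [DB|DB] := eqVneq D B.
    by exists (A `|` B); rewrite !inE ?eqxx // -DB xD orbT.
  by exists D; rewrite // !inE DA DB DC orbT.
Qed.

Lemma refinement_pigeonhole C : refinement C -> (k < #|` C|)%N ->
  exists i A B, [/\ A \in C, B \in C, A != B, A `<=` O i & B `<=` O i].
Proof.
move=> [_ _ sub _] kC.
(* Quantifying over the finite type of members of C makes the choice of i a function into 'I_k,
   which cannot be injective. *)
have sub' (a : C) : exists i, fsval a `<=` O i by apply: sub; exact: valP.
pose f a := xchoose (sub' a).
have fP a : fsval a `<=` O (f a) := xchooseP (sub' a).
have /injectivePn[a [b ab fab]] : ~~ injectiveb f.
  apply/negP => /injectiveP/leq_card.
  by rewrite card_ord -cardfE leqNgt kC.
exists (f a), (fsval a), (fsval b); split; try exact: valP.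
- by rewrite val_eqE.
- exact: fP.
- by rewrite fab; exact: fP.
Qed.

(** Some member meets the nonempty [O i] and, lying in a single cluster, lies in [O i]. Nonempty
    members cannot lie in two clusters, hence injectivity. This yields both the lower bound k on the
    size of C and the case of equality. *)
Lemma refinement_choice C : refinement C ->
  exists g : 'I_k -> {fset point},
    injective g /\ forall i, g i \in C /\ g i `<=` O i.
Proof.
move=> [n0 _ sub cov].
have ex i : exists A, (A \in C) && (A `<=` O i).
  have /fset0Pn[x xi] := O_neq0 i.
  have [A AC xA] := cov _ _ xi; have [j Aj] := sub _ AC.
  by exists A; rewrite AC (O_inj xi (fsubsetP Aj _ xA)).
pose g i := xchoose (ex i).
have gP i : g i \in C /\ g i `<=` O i by apply/andP/(xchooseP (ex i)).
exists g; split=> // i j gij.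
have [gC gi] := gP i; have [_ gj] := gP j.
have /fset0Pn[x xg] := n0 _ gC.
apply: O_inj (fsubsetP gi _ xg) _; apply: (fsubsetP gj).
by rewrite -gij.
Qed.

Lemma card_codom_fset (g : 'I_k -> {fset point}) : injective g ->
  #|` [fset g i | i : 'I_k]| = k.
Proof. by move=> g_inj; rewrite card_imfset //= -cardT card_ord. Qed.

Lemma refinement_card C : refinement C -> (k <= #|` C|)%N.
Proof.
move=> /refinement_choice[g [g_inj gP]].
rewrite -{1}(card_codom_fset g_inj); apply: fsubset_leq_card.
by apply/fsubsetP => _ /imfsetP[i _ ->]; have [] := gP i.
Qed.

(** With only k members, the chosen [g i] exhaust C. A point of [O i] then lies in some [g j], where
    j = i by disjointness, so [g i] fills [O i]. *)
Lemma refinement_eq C : refinement C -> #|` C| = k -> C = [fset O i | i : 'I_k].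
Proof.
move=> rC Ck; have [g [g_inj gP]] := refinement_choice rC.
have [_ _ _ cov] := rC.
have CE : C = [fset g i | i : 'I_k].
  apply/esym/eqP; rewrite eqEfcard (card_codom_fset g_inj) Ck leqnn andbT.
  by apply/fsubsetP => _ /imfsetP[i _ ->]; have [] := gP i.
rewrite [LHS]CE; apply: eq_imfset => // i; apply/eqP; rewrite eqEfsubset.
have [_ -> /=] := gP i; apply/fsubsetP => x xi.
have [A] := cov _ _ xi; rewrite CE => /imfsetP[j _ ->] xj.
have [_ gj] := gP j.
by rewrite (O_inj xi (fsubsetP gj _ xj)).
Qed.

Lemma ward_step_exists C : (1 < #|` C|)%N -> exists C', ward_step C C'.
Proof.
move=> C1.
have /fset0Pn[A AC] : C != fset0 by rewrite -cardfs_gt0 ltnW.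
have /fset0Pn[B] : C `\ A != fset0.
  by rewrite -cardfs_gt0; move: C1; rewrite (cardfsD1 A) AC.
rewrite !inE => /andP[BA BC].
pose F (p : C * C) := merge_cost (fsval p.1) (fsval p.2).
have p0 : [` AC] != [` BC] by rewrite -val_eqE /= eq_sym.
have := @arg_minP _ R _ ([` AC], [` BC]) (fun p => p.1 != p.2) F p0.
case=> -[a b] /= ab min.
exists ((fsval a `|` fsval b) |` (C `\ fsval a `\ fsval b)).
exists (fsval a), (fsval b); split; rewrite ?val_eqE //; try exact: valP.
move=> A' B' A'C B'C AB'.
by apply: (min ([` A'C], [` B'C])); rewrite /= -val_eqE.
Qed.

(** * Bounds on sizes and merge costs *)

Lemma card_le_size_ratio i j : #|` O i|%:R <= size_ratio O * #|` O j|%:R :> R.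
Proof.
rewrite -ler_pdivrMr ?card_gt0R // /size_ratio.
apply: le_trans (le_bigmax 0 _ i).
exact: (le_bigmax 0 (fun j => #|` O i|%:R / #|` O j|%:R)).
Qed.

Lemma enorm_le_max_radius i x : x \in O i -> enorm (x - centroid (O i)) <= max_radius O.
Proof.
move=> xi; rewrite /max_radius; apply: le_trans (le_bigmax 0 _ i).
exact: (le_bigmax_seq 0 x xpredT (fun x => enorm (x - centroid (O i)))).
Qed.

Lemma refinement_small_pair C A i : refinement C -> (k < #|` C|)%N ->
  A \in C -> A `<=` O i ->
  exists l A' B', [/\ A' \in C /\ B' \in C, A' != B', A' `<=` O l, B' `<=` O l
    & #|` A'|%:R <= size_ratio O * #|` A|%:R :> R].
Proof.
move=> rC kC AC Ai; have [n0 _ sub cov] := rC.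
have [OA|/fsubsetPn[x xi xA]] := boolP (O i `<=` A).
  have [l [A' [B' [A'C B'C AB A'l B'l]]]] := refinement_pigeonhole rC kC.
  exists l, A', B'; split=> //; apply: le_trans (le_trans (card_le_size_ratio l i) _).
    by rewrite ler_nat fsubset_leq_card.
  by have -> : A = O i by apply/eqP; rewrite eqEfsubset Ai.
(* The member B containing the missed point x shares x with [O i], so it lies in [O i] and pairs
   with A. *)
have [B BC xB] := cov _ _ xi; have [j Bj] := sub _ BC.
exists i, A, B; split=> //.
- by apply: contraNneq xA => ->.
- by rewrite (O_inj xi (fsubsetP Bj _ xB)).
(* It remains that the size ratio is at least 1, which the ratio of [O i] to itself shows. *)
apply: ler_peMl; first exact: ler0n.
have := card_le_size_ratio i i; rewrite -{1}[X in X <= _]mul1r ler_pM2r //.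
exact: card_gt0R.
Qed.

(** At radius zero [O i] would be a single point, with no room for two disjoint nonempty subsets.
    Positivity makes the bound in [merge_cost_same] strict. *)
Lemma max_radius_gt0 A B i : A != fset0 -> B != fset0 -> [disjoint A & B] ->
  A `<=` O i -> B `<=` O i -> 0 < max_radius O.
Proof.
move=> /fset0Pn[x xA] /fset0Pn[y yB] /fdisjointP dAB Ai Bi.
rewrite ltNge; apply/negP => r0.
have center z : z \in O i -> z = centroid (O i).
  move=> zi; apply/eqP; rewrite -subr_eq0; apply/eqP/enorm_eq0/le_anti.
  by rewrite enorm_ge0 andbT (le_trans (enorm_le_max_radius zi)).
have := dAB _ xA.
by rewrite (center x (fsubsetP Ai _ xA)) -(center y (fsubsetP Bi _ yB)) yB.
Qed.

Lemma centroid_near A i : A != fset0 -> A `<=` O i ->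
  enorm (centroid A - centroid (O i)) <= max_radius O.
Proof.
by move=> A0 /fsubsetP Ai; apply: centroid_ball => // q /Ai; exact: enorm_le_max_radius.
Qed.

Lemma merge_cost_same A B i : A != fset0 -> B != fset0 -> [disjoint A & B] ->
  A `<=` O i -> B `<=` O i ->
  merge_cost A B < 4 * #|` A|%:R * max_radius O ^+ 2.
Proof.
move=> A0 B0 dAB Ai Bi; rewrite merge_costE //.
have r0 := max_radius_gt0 A0 B0 dAB Ai Bi.
have a0 := card_gt0R A0; have b0 := card_gt0R B0.
have near : enorm (centroid A - centroid B) <= 2 * max_radius O.
  rewrite -(subrKA (centroid (O i))) (le_trans (enormD _ _)) //.
  rewrite -[X in _ + X]enormN opprB mulr_natl mulr2n.
  by apply: lerD; exact: centroid_near.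
have near2 : enorm (centroid A - centroid B) ^+ 2 <= 4 * max_radius O ^+ 2.
  have -> : 4 * max_radius O ^+ 2 = (2 * max_radius O) ^+ 2 by ring.
  by rewrite lerXn2r ?nnegrE ?enorm_ge0 // mulr_ge0 // ltW.
apply: (@le_lt_trans _ _ (#|` A|%:R * #|` B|%:R / (#|` A|%:R + #|` B|%:R) *
                         (4 * max_radius O ^+ 2))).
  by rewrite ler_wpM2l // divr_ge0 ?mulr_ge0 ?addr_ge0 // ltW.
have -> : 4 * #|` A|%:R * max_radius O ^+ 2 = #|` A|%:R * (4 * max_radius O ^+ 2).
  by ring.
(* The strict gain is ab/(a+b) < a. *)
rewrite ltr_pM2r ?mulr_gt0 ?exprn_gt0 //.
rewrite ltr_pdivrMr ?addr_gt0 //; nra.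
Qed.

Lemma merge_cost_distinct eps A B i j : 0 < eps ->
  center_separation (2 + 2 * Num.sqrt (2 * size_ratio O) + eps) O ->
  A != fset0 -> B != fset0 -> [disjoint A & B] ->
  A `<=` O i -> B `<=` O j -> i != j -> #|` A|%:R <= #|` B|%:R :> R ->
  4 * (size_ratio O * #|` A|%:R) * max_radius O ^+ 2 <= merge_cost A B.
Proof.
move=> e0 sep A0 B0 dAB Ai Bj ij leAB; rewrite merge_costE //.
have a0 := card_gt0R A0; have b0 := card_gt0R B0.
have nu0 : 0 <= size_ratio O.
  rewrite -(pmulr_lge0 _ (card_gt0R (O_neq0 i))).
  exact: le_trans (ler0n _ _) (card_le_size_ratio i i).
have r0 : 0 <= max_radius O.
  exact: le_trans (enorm_ge0 _) (centroid_near A0 Ai).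
have := sep _ _ ij.
set s := Num.sqrt _; set r := max_radius O in r0 * => far_centers.
have s0 : 0 <= s := sqrtr_ge0 _.
have s2 : s ^+ 2 = 2 * size_ratio O by rewrite sqr_sqrtr ?mulr_ge0.
(* Each centroid is within r of its center; the leading 2 of the separation constant pays for both
   shifts. *)
have far : 2 * s * r <= enorm (centroid A - centroid B).
  have tri : enorm (centroid (O j) - centroid (O i)) <=
             r + enorm (centroid A - centroid B) + r.
    have -> : centroid (O j) - centroid (O i) =
        - (centroid B - centroid (O j)) + - (centroid A - centroid B) +
        (centroid A - centroid (O i)) by rewrite !opprB !subrKA.
    apply: le_trans (enormD _ _) (lerD (le_trans (enormD _ _) _) _).
      by rewrite !enormN lerD // centroid_near.
    exact: centroid_near.
  have er : 0 <= eps * r by rewrite mulr_ge0 // ltW.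
  lra.
have far2 : 8 * size_ratio O * r ^+ 2 <= enorm (centroid A - centroid B) ^+ 2.
  have -> : 8 * size_ratio O * r ^+ 2 = (2 * s * r) ^+ 2.
    by rewrite !exprMn s2; ring.
  by rewrite lerXn2r ?nnegrE ?enorm_ge0 ?mulr_ge0.
(* Since a <= b, ab/(a+b) is at least a/2; times 8 nu r^2 this gives the constant 4. *)
have half : #|` A|%:R / 2 <= #|` A|%:R * #|` B|%:R / (#|` A|%:R + #|` B|%:R) :> R.
  rewrite ler_pdivlMr ?addr_gt0 //; nra.
have -> : 4 * (size_ratio O * #|` A|%:R) * r ^+ 2 =
          #|` A|%:R / 2 * (8 * size_ratio O * r ^+ 2).
  by field.
by apply: ler_pM => //; rewrite ?mulr_ge0 ?sqr_ge0 ?invr_ge0.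
Qed.

(** * Ward's run stays inside the optimal clusters *)

Lemma merge_costC A B : merge_cost A B = merge_cost B A :> R.
Proof. by rewrite /merge_cost fsetUC addrAC. Qed.

Lemma ward_merges_within eps C A B : 0 < eps ->
  center_separation (2 + 2 * Num.sqrt (2 * size_ratio O) + eps) O ->
  refinement C -> (k < #|` C|)%N -> A \in C -> B \in C -> A != B ->
  (forall A' B', A' \in C -> B' \in C -> A' != B' ->
     merge_cost A B <= merge_cost A' B') ->
  exists2 i, A `<=` O i & B `<=` O i.
Proof.
move=> e0 sep rC kC.
(* The conclusion and the merge cost are symmetric, so A may be taken as the smaller one, as
   [merge_cost_distinct] requires. *)
wlog leAB : A B / #|` A|%:R <= #|` B|%:R :> R => [wl|] AC BC AB min.
  have [/wl|/ltW/wl h] := leP (#|` A|%:R : R) (#|` B|%:R); first exact.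
  have [||i Bi Ai] // := h BC AC; last by exists i.
    by rewrite eq_sym.
  by move=> A' B'; rewrite merge_costC; exact: min.
have [n0 dC sub _] := rC.
have [[i Ai] [j Bj]] := (sub _ AC, sub _ BC).
have [ij|ij] := eqVneq i j; first by exists i; rewrite // ij.
have [l [A' [B' [[A'C B'C] AB' A'l B'l small]]]] :=
  refinement_small_pair rC kC AC Ai.
have cheap := merge_cost_same (n0 _ A'C) (n0 _ B'C) (dC _ _ A'C B'C AB') A'l B'l.
have dear := merge_cost_distinct e0 sep (n0 _ AC) (n0 _ BC) (dC _ _ AC BC AB)
  Ai Bj ij leAB.
(* A crossing pair is not minimal: D(A', B') < 4|A'|r^2 <= 4 nu |A| r^2 <= D(A, B). *)
have := min _ _ A'C B'C AB'; rewrite leNgt (lt_le_trans cheap) //.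
by apply: le_trans dear; rewrite ler_wpM2r ?sqr_ge0 // ler_wpM2l.
Qed.

Lemma ward_run_refinement eps m C : 0 < eps ->
  center_separation (2 + 2 * Num.sqrt (2 * size_ratio O) + eps) O ->
  ward_run P m C -> (m <= #|` P| - k)%N ->
  refinement C /\ (#|` C| + m)%N = #|` P|.
Proof.
move=> e0 sep; elim=> {m C} [_|m C C' _ IH [A [B [AC BC AB min ->]]] mP].
  by split; [exact: refinement_singletons | rewrite addn0 card_singletons].
have [rC cardC] := IH (ltnW mP).
(* Before merge m+1 <= |P| - k, the count |C| = |P| - m still exceeds k. *)
have kC : (k < #|` C|)%N.
  by rewrite -(ltn_add2r m) cardC -ltn_subRL.
have [i Ai Bi] := ward_merges_within e0 sep rC kC AC BC AB min.
split; first exact: refinement_merge Ai Bi.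
by rewrite addnS -addSn -card_merge.
Qed.

(** Before each merge more than k >= 1 members remain, so there is a pair to merge and the run
    cannot get stuck. *)
Lemma ward_run_exists eps m : (0 < k)%N -> 0 < eps ->
  center_separation (2 + 2 * Num.sqrt (2 * size_ratio O) + eps) O ->
  (m <= #|` P| - k)%N -> exists C, ward_run P m C.
Proof.
move=> k0 e0 sep; elim: m => [_|m IH mP].
  by exists (singletons P); exact: WardStart.
have [C run] := IH (ltnW mP).
have [_ cardC] := ward_run_refinement e0 sep run (ltnW mP).
have [|C' step] := @ward_step_exists C; last by exists C'; exact: WardMerge step.
by apply: leq_ltn_trans k0 _; rewrite -(ltn_add2r m) cardC -ltn_subRL.
Qed.

End Ward.

Theorem theorem21 (R : realType) (d k : nat) (hk : (0 < k)%N)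
    (P : {fset 'rV[R]_d}) (O : 'I_k -> {fset 'rV[R]_d})
    (hO : optimal_kmeans P O)
    (eps : R) (heps : 0 < eps)
    (hsep : center_separation
              (2 + 2 * Num.sqrt (2 * size_ratio O) + eps) O)
    (C : {fset {fset 'rV[R]_d}}) :
  ward_clustering P k C <-> C = [fset O i | i : 'I_k].
Proof.
have [partO _] := hO.
have run_eq D : ward_clustering P k D -> D = [fset O i | i : 'I_k].
  move=> run.
  have [rD cardD] := ward_run_refinement partO heps hsep run (leqnn _).
  apply: (refinement_eq partO rD); apply/eqP.
  (* The truncated difference is exact because k <= |P|: the singletons form a refinement, which has
     at least k members. *)
  rewrite -(eqn_add2r (#|` P| - k)) cardD subnKC //.
  rewrite -card_singletons; apply: (refinement_card partO).
  exact: refinement_singletons.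
split=> [|->]; first exact: run_eq.
(* Conversely, some complete run exists, and its outcome is the optimal family by the first
   direction. *)
have [D run] := ward_run_exists partO hk heps hsep (leqnn _).
by rewrite -(run_eq D run).
Qed.
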